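(* Let $M$ be a countable $\omega$-categorical structure and let $G=\mathrm{Aut}(M)$. Suppose that $H\le G$ is a closed subgroup which acts oligomorphically on $M$ and that $(G,H)$ has no compact quotients. Then there are $g_1,g_2\in G$ such that $H\cup\{g_1,g_2\}$ topologically generates $G$, i.e. the subgroup generated by $H\cup\{g_1,g_2\}$ is dense in $G$.
   Context: The language is countable. $\mathrm{Aut}(M)$ carries the topology of pointwise convergence. $H$ acts oligomorphically on $M$ if for every $n<\omega$ the action of $H$ on $M^n$ has finitely many orbits. $M^{\mathrm{eq}}$ is the expansion of $M$ by imaginary sorts (a sort for each $\emptyset$-definable quotient of a $\emptyset$-definable set); $\mathrm{Aut}(M)$ is identified with $\mathrm{Aut}(M^{\mathrm{eq}})$; $\mathrm{acl}^{\mathrm{eq}}(\emptyset)$ is the set of elements of $M^{\mathrm{eq}}$ algebraic over $\emptyset$. For a closed subgroup $H\le G$, the pair $(G,H)$ has no compact quotients if for every $g\in G$ there is $h\in H$ such that $g\restriction\mathrm{acl}^{\mathrm{eq}}(\emptyset)=h\restriction\mathrm{acl}^{\mathrm{eq}}(\emptyset)$ (here $\mathrm{acl}^{\mathrm{eq}}$ is computed in $M$). *)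

(* Defs.v *)
From HB Require Import structures.
From mathcomp Require Import all_boot monoid.
From mathcomp Require Import boolp classical_sets functions cardinality.
From mathcomp Require Import topology function_spaces.

Set Implicit Arguments.
Unset Strict Implicit.
Unset Printing Implicit Defensive.

Local Open Scope classical_set_scope.

(* The logic is many-sorted because M^eq is; one-sorted structures are treated
   below as structures with sort set [unit], so that there is a single notion of
   formula.  Sorts are allowed to be empty. *)

Record mslanguage := MSLanguage {
  mssort : Type;
  msfun : Type;
  msfun_ar : msfun -> finType;
  msfun_dom : forall f, msfun_ar f -> mssort;
  msfun_cod : msfun -> mssort;
  msrel : Type;
  msrel_ar : msrel -> finType;
  msrel_dom : forall r, msrel_ar r -> mssort }.

Record msstructure (L : mslanguage) := MSStructure {
  mscarrier :> mssort L -> Type;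
  msfun_interp : forall f : msfun L,
    (forall i : msfun_ar f, mscarrier (msfun_dom i)) -> mscarrier (msfun_cod f);
  msrel_interp : forall r : msrel L,
    (forall i : msrel_ar r, mscarrier (msrel_dom i)) -> Prop }.

(* [ctx : V -> mssort L] is a context: the free variables are the elements of V,
   and v has sort [ctx v]. *)
Inductive term (L : mslanguage) (V : Type) (ctx : V -> mssort L) :
    mssort L -> Type :=
| TVar (v : V) : term ctx (ctx v)
| TApp (f : msfun L) :
    (forall i : msfun_ar f, term ctx (msfun_dom i)) -> term ctx (msfun_cod f).

(* The quantified variable of [FAll] is [None : option V]. *)
Inductive formula (L : mslanguage) (V : Type) (ctx : V -> mssort L) : Type :=
| FBot
| FEq (s : mssort L) (t u : term ctx s)
| FRel (r : msrel L) (t : forall i : msrel_ar r, term ctx (msrel_dom i))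
| FImp (phi psi : formula ctx)
| FAll (s : mssort L)
    (phi : formula (fun o : option V => if o is Some v then ctx v else s)).

Section Semantics.
Context (L : mslanguage) (N : msstructure L).

Fixpoint eval V (ctx : V -> mssort L) (a : forall v, N (ctx v)) s
    (t : term ctx s) : N s :=
  match t in term _ s return N s with
  | TVar v => a v
  | TApp f ts => msfun_interp (fun i => eval a (ts i))
  end.

Definition extend V (ctx : V -> mssort L) s (a : forall v, N (ctx v)) (x : N s)
    (o : option V) : N (if o is Some v then ctx v else s) :=
  match o with Some v => a v | None => x end.

Fixpoint sat V (ctx : V -> mssort L) (phi : formula ctx) :
    (forall v, N (ctx v)) -> Prop :=
  match phi with
  | FBot => fun=> False
  | FEq s t u => fun a => eval a t = eval a u
  | FRel r ts => fun a => msrel_interp (fun i => eval a (ts i))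
  | FImp phi psi => fun a => sat phi a -> sat psi a
  | FAll s phi => fun a => forall x : N s, sat phi (extend a x)
  end.

(* acl(∅), sort by sort. *)
Definition acl0 (s : mssort L) : set (N s) :=
  [set x | exists phi : formula (fun _ : unit => s),
     sat phi (fun=> x) /\ finite_set [set y : N s | sat phi (fun=> y)]].

End Semantics.

Record language := Language {
  fsym : Type;
  far : fsym -> nat;
  rsym : Type;
  rar : rsym -> nat }.

Definition countable_language (L : language) :=
  countable [set: fsym L] /\ countable [set: rsym L].

Record structure (L : language) := Structure {
  carrier :> Type;
  fun_interp : forall f : fsym L, ('I_(far f) -> carrier) -> carrier;
  rel_interp : forall r : rsym L, ('I_(rar r) -> carrier) -> Prop }.

Definition one_sorted (L : language) : mslanguage :=
  @MSLanguage unit (fsym L) (fun f => 'I_(far f)) (fun _ _ => tt) (fun=> tt)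
    (rsym L) (fun r => 'I_(rar r)) (fun _ _ => tt).

Definition ms_of (L : language) (M : structure L) :
    msstructure (one_sorted L) :=
  @MSStructure (one_sorted L) (fun=> carrier M)
    (@fun_interp L M) (@rel_interp L M).

(* L-formulas with free variables in V; V = 'I_n for subsets of M^n,
   V = void for sentences. *)
Definition lformula (L : language) (V : Type) :=
  @formula (one_sorted L) V (fun=> tt).

Definition lsat (L : language) (M : structure L) V (phi : lformula L V)
    (a : V -> M) : Prop :=
  @sat _ (ms_of M) V (fun=> tt) phi a.

Definition definable (L : language) (M : structure L) V (X : set (V -> M)) :=
  exists phi : lformula L V, X = [set a | lsat phi a].

Definition is_isomorphism (L : language) (M N : structure L) (f : M -> N) :=
  [/\ bijective f,
      forall (s : fsym L) a, f (fun_interp a) = fun_interp (f := s) (f \o a)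
    & forall (r : rsym L) a, rel_interp a <-> rel_interp (r := r) (f \o a)].

Definition isomorphic (L : language) (M N : structure L) :=
  exists f : M -> N, is_isomorphism f.

Definition theory (L : language) := set (lformula L void).

Definition is_model (L : language) (T : theory L) (M : structure L) :=
  forall phi, T phi -> forall a : void -> M, lsat phi a.

Definition Th (L : language) (M : structure L) : theory L :=
  [set phi | forall a : void -> M, lsat phi a].

Definition denumerable (L : language) (M : structure L) :=
  countable [set: M] /\ infinite_set [set: M].

(* Exactly one model of cardinality ω, up to isomorphism. *)
Definition omega_categorical_theory (L : language) (T : theory L) :=
  (exists2 M, denumerable M & is_model T M) /\
  forall M N, denumerable M -> is_model T M ->
    denumerable N -> is_model T N -> isomorphic M N.

Definition omega_categorical (L : language) (M : structure L) :=
  omega_categorical_theory (Th M).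

Record aut (L : language) (M : structure L) := Aut {
  aut_fun :> M -> M;
  aut_isom : is_isomorphism aut_fun }.

Section AutGroup.
Context (L : language) (M : structure L).
Implicit Types g h k : aut M.

Lemma aut_eqP g h : (forall x, g x = h x) -> g = h.
Proof.
case: g h => [g Hg] [h Hh] /= /funext gh; move: Hh; rewrite -gh => Hh.
by congr Aut; exact: Prop_irrelevance.
Qed.

Lemma aut_one_subproof : is_isomorphism (idfun : M -> M).
Proof. by split=> //; exists idfun. Qed.

Lemma aut_mul_subproof g h : is_isomorphism (g \o h).
Proof.
case: (aut_isom g) (aut_isom h) => bg fg rg [bh fh rh]; split.
- exact: bij_comp.
- by move=> s a /=; rewrite fh fg.
- by move=> r a; rewrite rh rg.
Qed.

Lemma aut_inv_subproof g :
  {g' : M -> M | [/\ is_isomorphism g', cancel g g' & cancel g' g]}.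
Proof.
apply: cid; case: (aut_isom g) => -[g' gK g'K] fg rg.
have E T (a : T -> M) : g \o (g' \o a) = a by apply: funext => i /=.
exists g'; split=> //; split; first by exists g.
- by move=> s a; rewrite -[a in LHS]E -fg gK.
- by move=> r a; rewrite -[a in X in X <-> _]E -rg.
Qed.

Definition aut_one : aut M := Aut aut_one_subproof.
Definition aut_mul g h : aut M := Aut (aut_mul_subproof g h).
Definition aut_inv g : aut M :=
  let: exist _ (And3 isom_g' _ _) := aut_inv_subproof g in Aut isom_g'.

Lemma aut_mulA : associative aut_mul.
Proof. by move=> g h k; apply: aut_eqP. Qed.

Lemma aut_mul1 : left_id aut_one aut_mul.
Proof. by move=> g; apply: aut_eqP. Qed.

Lemma aut_mulr1 : right_id aut_one aut_mul.
Proof. by move=> g; apply: aut_eqP. Qed.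

Lemma aut_mulV : left_inverse aut_one aut_inv aut_mul.
Proof.
move=> g; rewrite /aut_inv; case: aut_inv_subproof => g' [? ? ?].
exact: aut_eqP.
Qed.

Lemma aut_mulrV : right_inverse aut_one aut_inv aut_mul.
Proof.
move=> g; rewrite /aut_inv; case: aut_inv_subproof => g' [? ? ?].
exact: aut_eqP.
Qed.

HB.instance Definition _ := gen_eqMixin (aut M).
HB.instance Definition _ := gen_choiceMixin (aut M).
HB.instance Definition _ :=
  isGroup.Build (aut M) aut_mulA aut_mul1 aut_mulr1 aut_mulV aut_mulrV.

(* Pointwise convergence, M being discrete. *)
HB.instance Definition _ := Topological.copy (aut M)
  (initial_topology
     (@aut_fun L M :
        aut M -> {ptws {classic M} -> discrete_topology {classic M}})).

End AutGroup.

Definition is_subgroup (G : groupType) (H : set G) :=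
  [/\ H 1%g, forall g h, H g -> H h -> H (g * h)%g
    & forall g, H g -> H (g^-1)%g].

Definition generated_subgroup (G : groupType) (X : set G) : set G :=
  smallest (@is_subgroup G) X.

Definition tuple_orbit (L : language) (M : structure L) (H : set (aut M)) n
    (a : 'I_n -> M) : set ('I_n -> M) :=
  [set g \o a | g in H].

Definition oligomorphic (L : language) (M : structure L) (H : set (aut M)) :=
  forall n, finite_set (range (@tuple_orbit L M H n)).

(* A ∅-definable equivalence relation E on a ∅-definable D ⊆ M^n. *)
Record imaginary_sort (L : language) (M : structure L) := ImaginarySort {
  eq_dim : nat;
  eq_dom : set ('I_eq_dim -> M);
  eq_rel : ('I_eq_dim -> M) -> ('I_eq_dim -> M) -> Prop;
  eq_dom_definable : definable eq_dom;
  eq_rel_definable :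
    definable [set c : 'I_eq_dim + 'I_eq_dim -> M |
                eq_rel (c \o inl) (c \o inr)];
  eq_rel_dom : forall a b, eq_rel a b -> eq_dom a /\ eq_dom b;
  eq_rel_refl : forall a, eq_dom a -> eq_rel a a;
  eq_rel_sym : forall a b, eq_rel a b -> eq_rel b a;
  eq_rel_trans : forall b a c, eq_rel a b -> eq_rel b c -> eq_rel a c }.

Arguments eq_dom {L M} i _.
Arguments eq_rel {L M} i _ _.

Section Meq.
Context (L : language) (M : structure L).

(* The quotient D/E, as a set of classes [eq_rel a]. *)
Definition eq_quotient (Q : imaginary_sort M) :=
  {C : set ('I_(eq_dim Q) -> M) | exists2 a, eq_dom Q a & C = eq_rel Q a}.

(* [None] is the home sort. *)
Definition eq_sort := option (imaginary_sort M).

Definition eq_carrier (s : eq_sort) : Type :=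
  match s with None => M | Some Q => eq_quotient Q end.

(* Besides the symbols of L there is, for each imaginary sort, a relation symbol
   for the graph of the projection D -> D/E (a relation, since D need not be all
   of M^n); its last argument, indexed by [None], is the class. *)
Definition eq_relsym : Type := rsym L + imaginary_sort M.

Definition eq_relsym_ar (r : eq_relsym) : finType :=
  match r with inl r => 'I_(rar r) | inr Q => option 'I_(eq_dim Q) end.

Definition eq_relsym_dom (r : eq_relsym) : eq_relsym_ar r -> eq_sort :=
  match r with
  | inl r => fun=> None
  | inr Q => fun o => if o is Some _ then None else Some Q
  end.

Definition eq_language : mslanguage :=
  @MSLanguage eq_sort (fsym L) (fun f => 'I_(far f)) (fun _ _ => None)
    (fun=> None) eq_relsym eq_relsym_ar eq_relsym_dom.

Definition eq_relsym_interp (r : eq_relsym) :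
    (forall i : eq_relsym_ar r, eq_carrier (eq_relsym_dom i)) -> Prop :=
  match r with
  | inl r => fun c => rel_interp (r := r) c
  | inr Q => fun c => sval (c None) = eq_rel Q (fun i => c (Some i))
  end.

Definition Meq : msstructure eq_language :=
  @MSStructure eq_language eq_carrier (@fun_interp L M) eq_relsym_interp.

Lemma eval_aut (g : aut M) V (ctx : V -> mssort (one_sorted L)) (a : V -> M) s
    (t : term ctx s) :
  g (@eval _ (ms_of M) V ctx a s t) = @eval _ (ms_of M) V ctx (g \o a) s t.
Proof.
elim: t => [v|f ts IH] //=; have [_ fg _] := aut_isom g.
by rewrite fg; congr fun_interp; apply: funext => i; exact: IH.
Qed.

Lemma sat_aut (g : aut M) V (ctx : V -> mssort (one_sorted L)) (a : V -> M)
    (phi : formula ctx) :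
  @sat _ (ms_of M) V ctx phi a <-> @sat _ (ms_of M) V ctx phi (g \o a).
Proof.
have [[g' gK g'K] _ rg] := aut_isom g.
elim: phi a => {V ctx} [V ctx|V ctx s t u|V ctx r ts|V ctx phi IH1 psi IH2
  |V ctx s phi IH] a //=.
- by rewrite -!eval_aut; split=> [->//|/(can_inj gK)].
- rewrite rg; set b := (X in rel_interp X <-> _).
  set c := (X in _ <-> rel_interp X).
  by have -> : b = c by apply: funext => i; exact: eval_aut.
- by rewrite (propext (IH1 a)) (propext (IH2 a)).
- have E x : extend (N := ms_of M) (ctx := ctx) (s := s) (g \o a) (g x) =
             g \o extend (N := ms_of M) (ctx := ctx) (s := s) a x.
    by apply: funext => -[].
  split=> H x; last by apply/IH; rewrite -E; exact: H.
  by rewrite -[x]g'K E; exact/(IH _).1/H.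
Qed.

Lemma eq_dom_aut (g : aut M) (Q : imaginary_sort M) a :
  eq_dom Q a -> eq_dom Q (g \o a).
Proof. by have [phi ->] := eq_dom_definable Q; move=> /sat_aut; exact. Qed.

Lemma eq_rel_aut (g : aut M) (Q : imaginary_sort M) a b :
  eq_rel Q a b -> eq_rel Q (g \o a) (g \o b).
Proof.
have [phi E] := eq_rel_definable Q; move=> ab.
pose c v := match v with inl i => a i | inr i => b i end.
have sat_rel (d : 'I_(eq_dim Q) + 'I_(eq_dim Q) -> M) :
    eq_rel Q (d \o inl) (d \o inr) = lsat phi d.
  by have := congr1 (fun X => X d) E.
have : lsat phi c by rewrite -sat_rel.
by move/(sat_aut g); rewrite -[sat _ _]/(lsat phi (g \o c)) -sat_rel.
Qed.

Lemma act_subproof (g : aut M) (Q : imaginary_sort M) (C : eq_quotient Q) :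
  exists2 a, eq_dom Q a & [set g \o b | b in sval C] = eq_rel Q a.
Proof.
case: C => _ /= [a Da ->]; exists (g \o a); first exact: eq_dom_aut.
apply/seteqP; split=> [_ [b ab <-]|b gab]; first exact: eq_rel_aut.
exists (aut_inv g \o b); last first.
  by apply: funext => i; have := congr1 (@^~ (b i) \o @aut_fun L M) (aut_mulrV g).
have /(eq_rel_aut (aut_inv g)) := gab; congr (eq_rel Q _ _).
by apply: funext => i; have := congr1 (@^~ (a i) \o @aut_fun L M) (aut_mulV g).
Qed.

(* The identification of Aut(M) with Aut(M^eq): g maps a class C to its image
   under the action of g on tuples. *)
Definition act (g : aut M) (s : mssort eq_language) : Meq s -> Meq s :=
  match s return Meq s -> Meq s with
  | None => aut_fun g
  | Some Q => fun C => exist _ _ (act_subproof g C)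
  end.

Definition no_compact_quotients (H : set (aut M)) :=
  forall g : aut M, exists2 h, H h &
    forall (s : mssort eq_language) (e : Meq s), acl0 e -> act g e = act h e.

End Meq.

(* Main.v *)
Require Import Defs.
From mathcomp Require Import all_boot monoid.
From mathcomp Require Import boolp classical_sets functions cardinality.
From mathcomp Require Import topology function_spaces.
From Stdlib Require Import Eqdep_dec PeanoNat.

Local Open Scope classical_set_scope.

Set Implicit Arguments.
Unset Strict Implicit.
Unset Printing Implicit Defensive.

(* Let K be generated by H, g1 and g2.  For a tuple a, the set X = K a is
   invariant under H, g1 and g2; density amounts to X being G-invariant.
   - If X has finite G-orbit, then X is a union of classes of a G-invariant
     equivalence relation with finitely many classes, whose classes lie in
     acl^eq(∅); H moves them as G does, so X is G-invariant.
   - If the stabilizer of X in G is not open, then X is moved by a generic g1: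
     since H is oligomorphic there are only countably many such X to consider.
   - If the stabilizer of X is open of infinite index, then X is an imaginary
     outside acl^eq(∅), and g2 can be chosen to move all of these at once.  It is
     built by back and forth through finite partial maps a -> b none of whose
     extensions fixes a point of acl(a) \ acl(∅).  Given c, one extends by a d
     with acl(ac) ∩ acl(bd) ⊆ acl(b): a fixed point in acl(ac) then lies in
     acl(b), hence, being fixed, in acl(a).  Such a d exists by Neumann's lemma
     and oligomorphy. *)

(** * Finite sets *)

Lemma finite_set_range T (A : set T) :
  finite_set A -> exists n (f : 'I_n -> T), A = range f.
Proof.
move=> /(finite_seqP (A : set {classic T})) [s ->].
exists (size s), (tnth (in_tuple s)); apply/seteqP; split=> [x /= /seq_tnthP|x].
  by move=> [i ->]; exists i.
by move=> [i _ <-] /=; exact: mem_tnth.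
Qed.

Lemma finite_set_subsets T (A : set T) :
  finite_set A -> finite_set [set B : set T | B `<=` A].
Proof.
move=> /finite_set_range [n [f ->]].
apply: (@sub_finite_set _ _ (range (fun s : {set 'I_n} => f @` [set` s]))).
  move=> B /= Bf; exists (finset (fun i => `[< B (f i) >])) => //.
  apply/seteqP; split=> [_ [i + <-]|x Bx]; first by
    rewrite /mkset finset.in_set => /asboolP.
  have [i _ fi] := Bf x Bx.
  by exists i; rewrite // /mkset finset.in_set; apply/asboolP; rewrite fi.
exact/finite_image/finite_finset.
Qed.



(** * Automorphisms and definable sets *)

Section Definable.
Context (L : language) (M : structure L).
Implicit Types (V W : Type).

Local Notation uterm V c s := (@term (one_sorted L) V c s).
Local Notation uformula V c := (@formula (one_sorted L) V c).
Local Notation ueval V c a s t := (@Defs.eval _ (ms_of M) V c a s t).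
Local Notation usat V c phi a := (@sat _ (ms_of M) V c phi a).

Lemma term_var V (c : V -> unit) s v :
  exists t : uterm V c s, forall a : V -> M, ueval V c a s t = a v.
Proof.
by have -> : s = c v; [case: s; case: (c v)|exists (TVar (L := one_sorted L) c v)].
Qed.

Lemma term_rename V W (r : V -> W) (c : V -> unit) (d : W -> unit) s
    (t : uterm V c s) :
  exists t' : uterm W d s, forall a : W -> M,
    ueval W d a s t' = ueval V c (a \o r) s t.
Proof.
elim: t => {s} [v|f ts IH]; first exact: term_var.
exists (TApp (f := f) (fun i => sval (cid (IH i)))) => a /=.
by congr fun_interp; apply: funext => i; exact: (svalP (cid (IH i))).
Qed.

(** Contexts are arbitrary maps to [unit], since under a quantifier a constant context becomes a
    [match] not convertible to [fun=> tt]. *)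
Lemma formula_rename V (c : V -> unit) (phi : uformula V c) W (r : V -> W)
    (d : W -> unit) :
  exists psi : uformula W d, forall a : W -> M,
    usat W d psi a <-> usat V c phi (a \o r).
Proof.
elim: phi W r d => {V c} [V c|V c s t u|V c R ts|V c phi IH1 psi IH2
    |V c s phi IH] W r d.
- by exists (FBot (L := one_sorted L) d).
- have [[t' Et] [u' Eu]] := (term_rename r d t, term_rename r d u).
  by exists (FEq t' u') => a /=; rewrite Et Eu.
- pose ts' i := cid (term_rename r d (ts i)).
  exists (FRel (r := R) (fun i => sval (ts' i))) => a /=.
  set x := (X in rel_interp X <-> _); set y := (X in _ <-> rel_interp X).
  by have -> : x = y by apply: funext => i; exact: (svalP (ts' i)).
- have [[phi' E1] [psi' E2]] := (IH1 W r d, IH2 W r d).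
  by exists (FImp phi' psi') => a /=; rewrite (propext (E1 a)) (propext (E2 a)).
- have [phi' E] := IH (option W) (omap r) (fun o => if o is Some v then d v else s).
  exists (FAll phi') => a /=.
  have X x : extend (N := ms_of M) (ctx := d) (s := s) a x \o omap r =
      extend (N := ms_of M) (ctx := c) (s := s) (a \o r) x.
    by apply: funext => -[].
  split=> H x; first by rewrite -X; apply/E; exact: H.
  by apply/E; rewrite [X in usat _ _ _ X]X; exact: H.
Qed.
Definition ext V (a : V -> M) (x : M) (o : option V) : M :=
  if o is Some v then a v else x.

Lemma definable_preim V W (r : V -> W) (X : set (V -> M)) :
  definable X -> definable [set a : W -> M | X (a \o r)].
Proof.
move=> [phi ->]; have [psi E] := formula_rename phi r (fun=> tt).
by exists psi; apply/seteqP; split=> a /E.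
Qed.

Lemma definableT V : definable [set: V -> M].
Proof.
exists (FImp (FBot (L := one_sorted L) (fun=> tt))
  (FBot (L := one_sorted L) (fun=> tt))).
by apply/seteqP; split=> // a _ /=.
Qed.

Lemma definableC V (X : set (V -> M)) : definable X -> definable (~` X).
Proof.
by move=> [phi ->]; exists (FImp phi (FBot (L := one_sorted L) (fun=> tt))).
Qed.

Lemma definableI V (X Y : set (V -> M)) :
  definable X -> definable Y -> definable (X `&` Y).
Proof.
move=> [phi ->] [psi ->].
pose neg chi := FImp chi (FBot (L := one_sorted L) (fun _ : V => tt)).
exists (neg (FImp phi (neg psi))); apply/seteqP; split=> a /=.
  by move=> [? ?]; apply.
by move=> /not_implyP [? /contrapT].
Qed.

Lemma definable_bigcap V n (X : 'I_n -> set (V -> M)) :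
  (forall i, definable (X i)) -> definable [set a | forall i, X i a].
Proof.
move=> defX; suff D (s : seq 'I_n) : definable [set a | forall i, i \in s -> X i a].
  have := D (enum 'I_n); congr definable; apply/seteqP; split=> a Xa i //.
  by apply: Xa; rewrite mem_enum.
elim: s => [|i s IH].
  by have := definableT V; congr definable; apply/seteqP; split.
have := definableI (defX i) IH; congr definable; apply/seteqP; split=> a.
  by move=> [Xi Xs] j; rewrite in_cons => /predU1P[->//|]; exact: Xs.
move=> Xs; split; first by apply: Xs; rewrite mem_head.
by move=> j js; apply: Xs; rewrite in_cons js orbT.
Qed.

Lemma definable_bigcup V n (X : 'I_n -> set (V -> M)) :
  (forall i, definable (X i)) -> definable [set a | exists i, X i a].
Proof.
move=> defX; have := definableC (definable_bigcap (fun i => definableC (defX i))).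
congr definable; apply/seteqP; split=> a /=.
  by move/existsNP => [i /contrapT]; exists i.
by move=> [i Xi] /(_ i).
Qed.

Lemma definable_proj V (X : set (option V -> M)) :
  definable X -> definable [set a | exists x, X (ext a x)].
Proof.
move=> /definableC [phi E].
have [psi Epsi] := formula_rename phi id
  (fun o : option V => if o is Some _ then tt else tt).
have : definable [set a : V -> M | forall x, ~ X (ext a x)].
  exists (FAll psi); apply/seteqP; split=> a /= H x.
    by apply/Epsi; have := H x; rewrite -[~ _]/((~` X) _) E.
  by have /Epsi := H x; rewrite -[~ _]/((~` X) _) E.
move/definableC; congr definable; apply/seteqP; split=> a /=.
  by move/existsNP => [x /contrapT]; exists x.
by move=> [x Xx] /(_ x).
Qed.

Lemma definable_eq V (v w : V) : definable [set a : V -> M | a v = a w].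
Proof.
by exists (FEq (TVar (L := one_sorted L) (fun=> tt) v)
  (TVar (L := one_sorted L) (fun=> tt) w)).
Qed.

Lemma definable_fun (f : Defs.fsym L) :
  definable [set a : option 'I_(far f) -> M | fun_interp (a \o Some) = a None].
Proof.
exists (FEq (TApp (L := one_sorted L) (f := f)
    (fun i => TVar (L := one_sorted L) (fun=> tt) (Some i)))
  (TVar (L := one_sorted L) (fun=> tt) None)).
by [].
Qed.

Lemma definable_rel (R : rsym L) :
  definable [set a : 'I_(rar R) -> M | rel_interp a].
Proof.
by exists (FRel (L := one_sorted L) (r := R)
  (fun i => TVar (L := one_sorted L) (fun=> tt) i)).
Qed.

Lemma definable_aut (g : aut M) V (X : set (V -> M)) a :
  definable X -> X a <-> X (g \o a).
Proof. by move=> [phi ->]; exact: sat_aut. Qed.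

(** Equality of complete types over the empty set; one implication suffices because definable sets
    are closed under complement. *)
Definition tpeq V (a b : V -> M) :=
  forall X : set (V -> M), definable X -> X a -> X b.

Lemma tpeq_sym V (a b : V -> M) : tpeq a b -> tpeq b a.
Proof. by move=> ab X dX Xb; apply: contrapT => /(ab _ (definableC dX)). Qed.

Lemma tpeq_preim V W (r : V -> W) (a b : W -> M) :
  tpeq a b -> tpeq (a \o r) (b \o r).
Proof. by move=> ab X /(definable_preim r) /ab. Qed.

Lemma aut_tpeq (g : aut M) V (a : V -> M) : tpeq a (g \o a).
Proof. by move=> X dX /(definable_aut g a dX). Qed.

(** * Elementary maps and back and forth *)

(** Graph of a partial elementary map; as equality is definable, such a relation is functional and
    injective. *)
Definition elementary (s : set (M * M)) :=
  forall V (u : V -> M * M), (forall v, s (u v)) -> tpeq (fst \o u) (snd \o u).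

Lemma elementary_inv s : elementary s -> elementary [set p | s (p.2, p.1)].
Proof.
move=> es V u su; apply: tpeq_sym.
by apply: (es V (fun v => ((u v).2, (u v).1))).
Qed.

Definition extends (g : aut M) (s : set (M * M)) := forall p, s p -> g p.1 = p.2.

Lemma extends_elementary g s : extends g s -> elementary s.
Proof.
move=> gs V u su; have -> : snd \o u = g \o (fst \o u).
  by apply: funext => v /=; rewrite gs.
exact: aut_tpeq.
Qed.

Definition finitely_many_orbits V :=
  exists n (r : 'I_n -> V -> M), forall a, exists i (g : aut M), a = g \o r i.

(** [P] is the set of conditions and [D i] the [i]-th requirement. The union of a chain of
    conditions is the graph of an automorphism, because each finite part of it lies in one
    condition. *)
Lemma back_and_forth (P : set (set (M * M))) (D : nat -> set (set (M * M))) s0 :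
  countable [set: M] -> P s0 ->
  (forall s, P s -> elementary s) ->
  (forall s c, P s -> exists d, P ((c, d) |` s)) ->
  (forall s d, P s -> exists c, P ((c, d) |` s)) ->
  (forall i s, P s -> exists t, [/\ s `<=` t, P t & D i t]) ->
  exists g : aut M, [/\ extends g s0,
    forall A, finite_set A -> exists s, [/\ P s, extends g s & A `<=` fst @` s]
    & forall i, exists s, [/\ P s, extends g s & D i s]].
Proof.
move=> /countable_injP [iota iotaI] Ps0 Pel forth back dense.
(* Stage [i] first meets [D i], then puts the point numbered [i] into domain and range. [D i] is
   recorded for a subset [t'] because it need not survive enlargement. *)
pose good i (s t : set (M * M)) := [/\ s `<=` t, P t,
  exists2 t', t' `<=` t & P t' /\ D i t' &
  forall c, iota c = i -> (fst @` t) c /\ (snd @` t) c].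
have step i s : P s -> exists t, good i s t.
  move=> Ps; have [t [st Pt Dt]] := dense i s Ps.
  have [[c ci]|nc] := pselect (exists c, iota c = i); last first.
    by exists t; split=> //; [exists t | move=> c ci; case: nc; exists c].
  have [d Pd] := forth t c Pt; have [e Pe] := back _ c Pd.
  exists ((e, c) |` ((c, d) |` t)); split=> //.
  - by move=> x /st; right; right.
  - by exists t => // x; right; right.
  - move=> c' ci'; have -> : c' = c by apply: iotaI; rewrite ?inE// ci' ci.
    by split; [exists (c, d); [right; left|]|exists (e, c); [left|]].
pose next i (s : {s | P s}) : {s | P s} :=
  exist _ (sval (cid (step i _ (svalP s))))
    (let: And4 _ Pt _ _ := svalP (cid (step i _ (svalP s))) in Pt).
pose sig := fix sig n := if n is n'.+1 then next n' (sig n') else exist _ s0 Ps0.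
pose sigma n := sval (sig n).
have sigmaS n : good n (sigma n) (sigma n.+1) by exact: (svalP (cid _)).
have sigmaP n : P (sigma n) by exact: svalP.
have sigma_le m n : m <= n -> sigma m `<=` sigma n.
  move=> /subnK <-; elim: (n - m) => // k IH x /IH; rewrite addSn.
  by have [+ _ _ _] := sigmaS (k + m); apply.
pose G := \bigcup_n sigma n.
have Gfin A : finite_set A -> A `<=` G -> exists n, A `<=` sigma n.
  move=> /finite_set_range [k [u ->]] uG.
  have /choice [m mP] i : exists n, sigma n (u i).
    by have [n _ ?] := uG (u i) (imageT _ _); exists n.
  exists (\max_i m i) => _ [i _ <-]; apply: sigma_le (mP i).
  exact: leq_bigmax.
have Gtp (V : finType) (u : V -> M * M) : (forall v, G (u v)) ->
    tpeq (fst \o u) (snd \o u).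
  move=> Gu; have [||n un] := Gfin (range u).
  - exact/finite_image/finite_finset.
  - by move=> _ [v _ <-].
  by apply: (Pel _ (sigmaP n)) => v; apply: un; exists v.
have Gdom c : exists d, G (c, d).
  have [_ _ _ /(_ c erefl) [[[c' d] s /= <-] _]] := sigmaS (iota c).
  by exists d; exists (iota c).+1.
have Gran d : exists c, G (c, d).
  have [_ _ _ /(_ d erefl) [_ [[c d'] s /= <-]]] := sigmaS (iota d).
  by exists c; exists (iota d).+1.
have Gfun c d c' d' : G (c, d) -> G (c', d') -> c = c' <-> d = d'.
  move=> Gd Gd'; pose u b := if b then (c, d) else (c', d').
  have tu : tpeq (fst \o u) (snd \o u) by apply: Gtp => -[].
  split=> E; first exact: (tu _ (definable_eq true false)).
  exact: (tpeq_sym tu (definable_eq true false)).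
have [f fP] := choice Gdom; have [f' f'P] := choice Gran.
have isof : is_isomorphism f.
  split.
  - exists f' => x.
      by have /(Gfun _ _ _ _ (f'P (f x)) (fP x)).2 := erefl (f x).
    by have /(Gfun _ _ _ _ (fP (f' x)) (f'P x)).1 := erefl (f' x).
  - move=> F a; pose u o := let x := ext a (fun_interp a) o in (x, f x).
    have tu : tpeq (fst \o u) (snd \o u) by apply: Gtp => o; exact: fP.
    have := tu _ (definable_fun F) erefl.
    by rewrite /= => <-.
  - move=> R a; pose u i := (a i, f (a i)).
    have tu : tpeq (fst \o u) (snd \o u) by apply: Gtp => o; exact: fP.
    split; first exact: (tu _ (definable_rel R)).
    exact: (tpeq_sym tu (definable_rel R)).
exists (Aut isof).
have ext_sigma n : extends (Aut isof) (sigma n).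
  move=> [c d] scd /=; have := Gfun _ _ _ _ (fP c) (_ : G (c, d)).
  by case=> //; [exists n | move=> + _; apply].
split; first exact: (ext_sigma 0).
  move=> A finA; have [||n An] := Gfin ((fun c => (c, f c)) @` A).
  - exact: finite_image.
  - by move=> _ [c _ <-].
  by exists (sigma n); split=> // c Ac; exists (c, f c) => //; apply: An; exists c.
move=> i; have [_ _ [t tsig [Pt Dt]] _] := sigmaS i.
by exists t; split=> // p /tsig; exact: ext_sigma.
Qed.

(** * Types and definable sets when there are finitely many orbits *)

Section Oligomorphic.
Hypothesis olig : forall V, finite_set [set: V] -> finitely_many_orbits V.

(* Finitely many orbits realize finitely many types, which are told apart by
   finitely many formulas. *)
Lemma isolated_type V (a : V -> M) : finite_set [set: V] ->
  exists X : set (V -> M), [/\ definable X, X a & forall b, X b -> tpeq a b].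
Proof.
move=> /olig [n [r rP]].
have sep i : exists Y : set (V -> M),
    [/\ definable Y, Y a & Y (r i) -> tpeq a (r i)].
  have [t|] := pselect (tpeq a (r i)).
    by exists setT; split; [exact: definableT|..].
  move=> /existsNP [Y /not_implyP [dY /not_implyP [Ya Yr]]]; exists Y; split=> //.
have [Y YP] := choice sep.
exists [set b | forall i, Y i b]; split.
- by apply: definable_bigcap => i; have [] := YP i.
- by move=> i; have [] := YP i.
- move=> b Yb; have [i [g bE]] := rP b; have [dY _ ti] := YP i.
  have Yri : Y i (r i) by apply/(definable_aut g (r i) dY); rewrite -bE.
  by move=> X dX /(ti Yri X dX); rewrite bE => /(definable_aut g _ dX).
Qed.

(** A definable set isolates the type of the domain of [s] together with [c]. Its projection holds
    of the domain, hence of the range, and a witness there is [d]. *)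
Lemma elementary_extend s c : finite_set s -> elementary s ->
  exists d, elementary ((c, d) |` s).
Proof.
move=> fs es; pose V := {p | s p}; pose u : V -> M * M := sval.
have fV : finite_set [set: option V].
  have [n [f sE]] := finite_set_range fs.
  have sf i : s (f i) by rewrite sE; exists i.
  rewrite -(_ : range (omap (fun i => exist s (f i) (sf i))) = setT).
    exact/finite_image/finite_finset.
  apply/seteqP; split=> // -[[p sp]|] _; last by exists None.
  have := sp; rewrite {1}sE => -[i _ fp]; exists (Some i) => //=.
  by congr Some; exact: eq_exist.
have [X [dX Xa aX]] := isolated_type (ext (fst \o u) c) fV.
have [d Xd] : [set a | exists x, X (ext a x)] (snd \o u).
  apply: (es V u (@svalP _ _) _ (definable_proj dX)).
  by exists c.
exists d => W w sw.
pose r x : option V :=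
  if pselect (s (w x)) is left sx then Some (exist s _ sx) else None.
have := tpeq_preim (r := r) (aX _ Xd); congr tpeq; apply: funext => x; rewrite /r /=;
  case: pselect => //= nsx; by have [->|] := sw x.
Qed.

Hypothesis M_countable : countable [set: M].

Lemma elementary_aut s : finite_set s -> elementary s -> exists g, extends g s.
Proof.
move=> fs es.
have [|||||g []] // := @back_and_forth [set t | finite_set t /\ elementary t]
  (fun=> setT) s M_countable.
- by move=> t [].
- move=> t c [ft et]; have [d ed] := elementary_extend c ft et.
  by exists d; split=> //; rewrite finite_setU; split=> //; exact: finite_set1.
- move=> t d [ft et].
  have fi (t' : set (M * M)) :
      finite_set t' -> finite_set [set p | t' (p.2, p.1)].
    move=> ft'; rewrite (_ : mkset _ = (fun p => (p.2, p.1)) @` t').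
      exact: finite_image.
    apply/seteqP; split=> [[x y] txy|_ [[x y] txy <-]] //=.
    by exists (y, x).
  have [c ec] := elementary_extend d (fi _ ft) (elementary_inv et).
  exists c; split; first by rewrite finite_setU; split=> //; exact: finite_set1.
  have := elementary_inv ec; congr elementary; apply/seteqP.
  by split=> -[x y] [[-> ->]|]; [left|right|left|right].
- by move=> _ t Pt; exists t; split.
- by move=> *; exists g.
Qed.

Lemma tpeq_aut V (a b : V -> M) : finite_set [set: V] ->
  tpeq a b -> exists g : aut M, b = g \o a.
Proof.
move=> fV ab.
have [||g gE] := @elementary_aut (range (fun v => (a v, b v))).
- exact: finite_image.
- move=> W u /= su; have /choice [r rE] w : exists v, (a v, b v) = u w.
    by have [v _ ?] := su w; exists v.
  have := tpeq_preim (r := r) ab.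
  by congr tpeq; apply: funext => w /=; rewrite -rE.
- by exists g; apply: funext => v /=; rewrite (gE (a v, b v)) //; exists v.
Qed.

(** An invariant set is a union of some of the finitely many orbits. Each orbit is definable: by
    homogeneity, a set isolating the type of its representative contains only conjugates of it. *)
Lemma invariant_definable V (X : set (V -> M)) : finite_set [set: V] ->
  (forall (g : aut M) a, X a -> X (g \o a)) -> definable X.
Proof.
move=> fV Xinv; have [n [r rP]] := olig fV.
have sep i : exists Y : set (V -> M),
    [/\ definable Y, X (r i) -> Y (r i) & Y `<=` X].
  have [Xr|nXr] := pselect (X (r i)); last first.
    exists set0; split=> //; rewrite -setCT; apply: definableC; exact: definableT.
  have [Y [dY Yr Yt]] := isolated_type (r i) fV.
  exists Y; split=> // b /Yt /tpeq_aut -/(_ fV) [g ->]; exact: Xinv.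
have [Y YP] := choice sep.
have := definable_bigcup (fun i => let: And3 dY _ _ := YP i in dY).
congr definable; apply/seteqP; split=> a /=.
  by move=> [i Yi]; have [_ _] := YP i; exact.
move=> Xa; have [i [g aE]] := rP a; exists i.
have [dY XY _] := YP i; rewrite aE; apply/(definable_aut g (r i) dY); apply: XY.
have := Xinv g^-1%g a Xa; congr X; rewrite aE; apply: funext => v /=.
by have := congr1 (@^~ (r i v) \o @aut_fun L M) (mulVg g).
Qed.

End Oligomorphic.
End Definable.

(** * An automorphism without non-algebraic fixed points *)

Section Neumann.
Context (G : groupType) (T : Type) (act : G -> T -> T).
Hypotheses (act1 : forall x, act 1%g x = x)
  (actM : forall g h x, act (g * h)%g x = act g (act h x)).

(* Neumann's lemma: K is not a finite union of cosets of stabilizers of points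
   with infinite orbits.  If the coset of the k with k y_j = g y_j avoids U at y_j,
   it is covered by the cosets for s alone, hence so are all its translates. *)
Lemma neumann (K : set G) (I : eqType) (y : I -> T) (s : seq I) :
  is_subgroup K ->
  (forall i, i \in s -> infinite_set [set act k (y i) | k in K]) ->
  forall U, finite_set U ->
  exists2 k, K k & forall i, i \in s -> ~ U (act k (y i)).
Proof.
move=> [K1 KM KV]; elim: s => [|j s IH] inf U fU; first by exists 1%g.
have [g Kg nUg] : exists2 g, K g & ~ U (act g (y j)).
  apply: contrapT => nex; apply: (inf j (mem_head _ _)).
  apply: (sub_finite_set _ fU) => _ [k Kk <-].
  by apply: contrapT => nU; apply: nex; exists k.
apply: contrapT => nex.
have cov k : K k -> ~ U (act k (y j)) -> exists2 i, i \in s & U (act k (y i)).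
  move=> Kk nU; apply: contrapT => nex'; apply: nex; exists k => // i.
  by rewrite in_cons => /predU1P[->//|si Ui]; apply: nex'; exists i.
(* [t u] carries [g y_j] to [u] if some element of [K] does. If [u = k y_j] lies in [U], then
   [(t u)^-1 k] agrees with [g] at [y_j], so it sends some [y_i] into [U]; to exclude this, the
   translates of [U] by the [t u] are added to [U]. *)
have /choice [t tP] u : exists t, K t /\
    ((exists2 t, K t & act t (act g (y j)) = u) -> act t (act g (y j)) = u).
  by have [[t Kt tu]|] := pselect (exists2 t, K t & act t (act g (y j)) = u);
    [exists t|exists 1%g].
have [||k Kk kU] := IH _ (U `|` \bigcup_(u in U) (act (t u) @` U)).
- by move=> i si; apply: inf; rewrite in_cons si orbT.
- rewrite finite_setU; split=> //; apply: bigcup_finite => // u _.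
  exact: finite_image.
have [Uk|nUk] := pselect (U (act k (y j))); last first.
  by have [i si Ui] := cov k Kk nUk; apply: (kU i si); left.
set u := act k (y j) in Uk; have [Kt tu] := tP u.
have {}tu : act (t u) (act g (y j)) = u.
  apply: tu; exists (k * g^-1)%g; first exact/KM/KV.
  by rewrite -actM mulgVK.
have E : act ((t u)^-1 * k)%g (y j) = act g (y j).
  by rewrite actM -/u -{2}tu -actM mulVg act1.
have [||i si Ui] := cov ((t u)^-1 * k)%g; first exact/KM/Kk/KV.
  by rewrite E.
apply: (kU i si); right; exists u => //.
by exists (act ((t u)^-1 * k)%g (y i)); rewrite // -actM mulVKg.
Qed.

End Neumann.

(** * Points with open stabilizer and algebraicity *)

Section Automorphisms.
Context (L : language) (M : structure L).
Implicit Types (g h k : aut M) (A B : set M).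

Lemma autK g : cancel g g^-1%g.
Proof. by move=> x; have := congr1 (@^~ x \o @aut_fun L M) (mulVg g). Qed.

Lemma autVK g : cancel g^-1%g g.
Proof. by move=> x; have := congr1 (@^~ x \o @aut_fun L M) (mulgV g). Qed.

Definition fixer A : set (aut M) := [set g | forall c, A c -> g c = c].

Lemma fixer_subgroup A : is_subgroup (fixer A).
Proof.
split=> [|g h gA hA c Ac|g gA c Ac] //=; first by rewrite hA// gA.
by rewrite -[in LHS](gA c Ac) autK.
Qed.

Lemma fixerS A B : A `<=` B -> fixer B `<=` fixer A.
Proof. by move=> AB g gB c /AB; exact: gB. Qed.

Lemma fixerJ g A k : fixer (g @` A) k -> fixer A (g^-1 * k * g)%g.
Proof. by move=> kA c Ac /=; rewrite kA ?autK//; exists c. Qed.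

Hypothesis olig : forall V, finite_set [set: V] -> finitely_many_orbits M V.

(** [A] and [g \o e] are listed together as one tuple [t g], so an automorphism carrying one such
    tuple to another fixes [A]. An orbit containing no [t r] with [r] in [P] gets the default 1. *)
Lemma fixer_orbits A (P : set (aut M)) V (e : V -> M) :
  finite_set A -> finite_set [set: V] -> P 1%g ->
  exists n (r : 'I_n -> aut M), (forall i, P (r i)) /\
    forall g, P g -> exists i k, fixer A k /\ g \o e = k \o (r i \o e).
Proof.
move=> /finite_set_range [m [f fA]] /finite_set_range [p [q qV]] P1.
pose t g (w : 'I_m + 'I_p) := match w with inl i => f i | inr j => g (e (q j)) end.
have [n [rho rhoP]] := olig (finite_finset (X := [set: 'I_m + 'I_p])).
have /choice [r rP] i : exists r, P r /\
    ((exists2 r, P r & exists h, t r = h \o rho i) -> exists h, t r = h \o rho i).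
  by have [[r Pr hr]|] := pselect (exists2 r, P r & exists h, t r = h \o rho i);
    [exists r|exists 1%g].
exists n, r; split=> [i|g Pg]; first by have [] := rP i.
have [i [h tg]] := rhoP (t g); have [_ []] := rP i; first by exists g => //; exists h.
move=> h' tr; have E w : t g w = (h * h'^-1)%g (t (r i) w).
  by rewrite tg tr /= autK.
exists i, (h * h'^-1)%g; split.
  by rewrite fA => _ [j _ <-]; exact: esym (E (inl j)).
apply: funext => v; have [j _ <-] : range q v by rewrite -qV.
exact: (E (inr j)).
Qed.

Section FixedPoints.
Context (T : Type) (act : aut M -> T -> T).
Hypotheses (act1 : forall x, act 1%g x = x)
  (actM : forall g h x, act (g * h)%g x = act g (act h x)).

Lemma actK g x : act g^-1%g (act g x) = x.
Proof. by rewrite -actM mulVg act1. Qed.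

(* The points of M^eq are modelled by the points of [T] with open stabilizer. *)
Definition algebraic A x := finite_set [set act k x | k in fixer A].

Definition open_stab x := exists2 A, finite_set A & forall g, fixer A g -> act g x = x.

Lemma algebraicS A B x : A `<=` B -> algebraic A x -> algebraic B x.
Proof. by move=> AB; apply: sub_finite_set; exact/image_subset/fixerS. Qed.

Lemma algebraicJ g A x : algebraic A x -> algebraic (g @` A) (act g x).
Proof.
move=> /(finite_image (act g)); apply: sub_finite_set => _ [k kA <-].
exists (act (g^-1 * k * g)%g x); first by exists (g^-1 * k * g)%g => //; exact: fixerJ.
by rewrite -!actM !mulgA mulgV mul1g.
Qed.

(** The point [g x] depends only on [g \o e], as the fixer of [e] fixes [x]. So the orbit of [x]
    splits into finitely many orbits of [fixer B], and the algebraic points fill the finite ones. *)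
Lemma finite_algebraic_orbit B x : finite_set B -> open_stab x ->
  finite_set [set y | (exists g, y = act g x) /\ algebraic B y].
Proof.
move=> fB [E /finite_set_range [m [e ->]] Ex].
have [n [r [_ rP]]] := fixer_orbits (P := setT) e fB finite_finset I.
apply: (@sub_finite_set _ _ (\bigcup_(i in [set i | algebraic B (act (r i) x)])
    [set act k (act (r i) x) | k in fixer B])).
  move=> _ [[g ->] gB]; have [i [k [kB kE]]] := rP g I.
  have gE : act g x = act k (act (r i) x).
    rewrite -actM -[act g x](@actK (k * r i)^-1)%g invgK; congr act.
    rewrite -actM Ex// => _ [j _ <-] /=.
    rewrite (_ : g (e j) = (k * r i)%g (e j)) ?autK//.
    exact: (congr1 (@^~ j) kE).
  exists i; last by exists k.
  rewrite /= /algebraic; move: gB; rewrite /algebraic; apply: sub_finite_set.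
  move=> _ [h hB <-]; exists (h * k^-1)%g.
    by have [_ M1 V1] := fixer_subgroup B; apply: M1 => //; exact: V1.
  by rewrite gE -!actM mulgVK.
apply: bigcup_finite => //; exact: finite_finset.
Qed.

(* If no k works, pick a bad x_i for each of the finitely many orbits of
   fixer (B `|` C) on the points k d0.  The translates of the x_i by
   fixer (B `|` C) are finitely many, as x_i is algebraic over C, and none is
   algebraic over B; by Neumann's lemma some k^-1 in fixer B sends none of them
   to a point algebraic over d0 |` B. *)
Lemma independent_extension B C d0 : finite_set B -> finite_set C ->
  exists2 k, fixer B k & forall x, open_stab x -> algebraic C x ->
    ~ algebraic B x -> ~ algebraic (k d0 |` B) x.
Proof.
move=> fB fC; have fBC : finite_set (B `|` C) by rewrite finite_setU.
have [B1 BM BV] := fixer_subgroup B.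
apply: contrapT => nex.
have bad k : fixer B k -> exists x, [/\ open_stab x, algebraic C x,
    ~ algebraic B x & algebraic (k d0 |` B) x].
  move=> Bk; apply: contrapT => nx; apply: nex; exists k => // x *.
  by move=> ?; apply: nx; exists x.
have [n [r [rB rP]]] :=
  fixer_orbits (P := fixer B) (fun _ : unit => d0) fBC finite_finset B1.
have /choice [x xP] i := bad _ (rB i).
have [s sE] : exists s : seq {classic T},
    \bigcup_i [set act u (x i) | u in fixer (B `|` C)] = [set` s].
  apply/finite_seqP; apply: bigcup_finite; first exact: finite_finset.
  move=> i _; have [_ Cx _ _] := xP i.
  by apply: (algebraicS _ Cx) => ?; right.
pose U := \bigcup_i [set y | (exists g, y = act g (x i)) /\ algebraic (d0 |` B) y].
have fU : finite_set U.
  apply: bigcup_finite; first exact: finite_finset.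
  move=> i _; have [ox _ _ _] := xP i; apply: finite_algebraic_orbit => //.
  by rewrite finite_setU; split=> //; exact: finite_set1.
have [y ys|k kB kU] := neumann act1 actM (y := (id : {classic T} -> T)) (s := s)
  (fixer_subgroup B) _ fU.
  (* A translate of [x i] by an element of [fixer B] has the same orbit under [fixer B], which is
     infinite. *)
  have : [set` s] y by [].
  rewrite -sE => -[i _ [u uBC <-]]; have [_ _ nBx _] := xP i.
  move=> fo; apply: nBx; apply: sub_finite_set fo => _ [h hB <-].
  exists (h * u^-1)%g; last by rewrite -!actM mulgVK.
  by apply: BM => //; apply: BV; apply: fixerS uBC => ?; left.
(* As [k u] carries [r i d0] to [d0] and fixes [B], the point [k u (x i)] is algebraic over [B] and
   [d0]. So it lies in [U], contrary to the choice of [k]. *)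
have [i [u [uBC kE]]] := rP _ (BV _ kB).
have {}kE : k^-1%g d0 = u (r i d0) by exact: (congr1 (@^~ tt) kE).
have [_ _ _ alg] := xP i.
apply: (kU (act u (x i))).
  by have : (\bigcup_i [set act u (x i) | u in fixer (B `|` C)]) (act u (x i));
    [exists i => //; exists u|rewrite sE].
exists i => //; split; first by exists (k * u)%g; rewrite actM.
have := algebraicJ (k * u)%g alg; rewrite actM; congr algebraic.
rewrite image_setU image_set1 /= -kE autVK; congr (_ `|` _).
apply/seteqP; split=> [_ [c Bc <-]|c Bc].
  by rewrite /= uBC ?kB//; left.
by exists c; rewrite //= uBC ?kB//; left.
Qed.

(** * Back and forth without non-algebraic fixed points *)

Hypothesis M_countable : countable [set: M].

Lemma extends_ran g (s : set (M * M)) : extends g s -> snd @` s = g @` (fst @` s).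
Proof.
move=> gs; rewrite image_comp; apply/seteqP.
by split=> _ [p sp <-]; exists p => //=; rewrite gs.
Qed.

Lemma extends_inv g (s : set (M * M)) :
  extends g s -> extends g^-1%g [set p | s (p.2, p.1)].
Proof. by move=> gs [c d] /gs /= <-; rewrite autK. Qed.

(** Quantifying over all extensions makes this a property of the finite map alone. An infinite
    [range (act^~ x)] says that [x] is not algebraic over the empty set. *)
Definition repelling (s : set (M * M)) := [/\ finite_set s, exists g, extends g s &
  forall g x, extends g s -> open_stab x -> infinite_set (range (act^~ x)) ->
    algebraic (fst @` s) x -> act g x <> x].

(** If [h] extends the inverse and fixes [x], then [h^-1] extends [s] and fixes [x]; transport by
    [h] makes [x] algebraic over the domain of [s]. *)
Lemma repelling_inv s : repelling s -> repelling [set p | s (p.2, p.1)].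
Proof.
move=> [fs [g gs] rs]; split.
- rewrite (_ : mkset _ = (fun p => (p.2, p.1)) @` s); first exact: finite_image.
  apply/seteqP; split=> [[c d] scd|_ [[c d] scd <-]] //=.
  by exists (d, c).
- by exists g^-1%g; exact: extends_inv.
- move=> h x /extends_inv hs ox ix ax hx.
  have {}hs : extends h^-1%g s by move=> [c d] scd; exact: (hs (c, d)).
  have hVx : act h^-1%g x = x by rewrite -[in LHS]hx actK.
  apply: (rs _ _ hs ox ix _ hVx); move: (algebraicJ h ax); rewrite hx.
  congr algebraic; apply/seteqP; split=> [_ [_ [[c d] /= scd <-] <-]|].
    by exists (d, c) => //=; have /= <- := hs _ scd; rewrite autVK.
  move=> _ [[d c] scd <-] /=; exists c; first by exists (c, d).
  by have /= <- := hs _ scd; rewrite autVK.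
Qed.

Lemma repelling_forth s c : repelling s -> exists d, repelling ((c, d) |` s).
Proof.
move=> [fs [g0 g0s] rs].
have fA : finite_set (c |` fst @` s).
  by rewrite finite_setU; split; [exact: finite_set1|exact: finite_image].
(* [k] fixes the range of [s], so [k g0] still extends [s]; its value at [c] is the new [d]. *)
have [k kB kP] := independent_extension (g0 c) (finite_image snd fs) fA.
exists (k (g0 c)); split.
- by rewrite finite_setU; split=> //; exact: finite_set1.
- exists (k * g0)%g => p [->//|sp] /=; rewrite g0s// kB//; by exists p.
- move=> g x gs' ox ix ax gx.
  have gs : extends g s by move=> p sp; apply: gs'; right.
  rewrite image_setU image_set1 /= in ax.
  have ax' : algebraic (k (g0 c) |` snd @` s) x.
    have := algebraicJ g ax; rewrite gx image_setU image_set1 -extends_ran//.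
    by rewrite (gs' (c, k (g0 c))) //; left.
  have [nax|/contrapT ax''] := pselect (~ algebraic (snd @` s) x).
    exact: (kP x ox ax nax ax').
  apply: (rs g x gs ox ix _ gx).
  have := algebraicJ g^-1%g ax''; rewrite -[in act _ x]gx actK (extends_ran gs).
  congr algebraic; rewrite image_comp; apply/seteqP.
  split=> [_ [y sy <-]|y sy]; first by rewrite /= autK.
  by exists y => //=; rewrite autK.
Qed.

Theorem fixed_point_free : exists g, forall x, open_stab x ->
  infinite_set (range (act^~ x)) -> act g x <> x.
Proof.
have r0 : repelling set0.
  split=> //; first by exists 1%g.
  move=> g x _ _ ix ax; case: ix; apply: sub_finite_set ax => _ [k _ <-].
  by exists k => // c [].
have [|s c|s d|_ s rs|g [_ gA _]] :=
  back_and_forth (D := fun=> setT) M_countable r0.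
- by move=> s [_ [g gs] _]; exact: extends_elementary gs.
- exact: repelling_forth.
- move=> /repelling_inv /(repelling_forth d) [c /repelling_inv rc]; exists c.
  move: rc; congr repelling; apply/seteqP.
  by split=> -[x y] [[-> ->]|]; [left|right|left|right].
- by exists s; split.
(* Some stage has the finite support [E] of [x] in its domain, so [x] is algebraic over that
   domain. *)
exists g => x ox ix; have [E fE Ex] := ox; have [s [[_ _ rs] gs Es]] := gA E fE.
apply: (rs g x gs ox ix); apply: (sub_finite_set _ (finite_set1 x)) => _ [k ks <-].
by rewrite Ex// => c /Es; exact: ks.
Qed.

End FixedPoints.
End Automorphisms.

(** * Invariant sets of tuples *)

Section Invariants.
Context (L : language) (M : structure L).
Implicit Types (g h k : aut M).
Hypothesis M_countable : countable [set: M].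

Definition moves n (X : set ('I_n -> M)) g := exists a, ~ (X a <-> X (g \o a)).

(** A Baire category argument on finite partial maps that extend to automorphisms: each member of
    [S] gives a dense requirement, and there are countably many. *)
Lemma generic_mover (S : set {n & set ('I_n -> M)}) : countable S ->
  (forall p, S p -> forall A, finite_set A ->
    exists2 k, fixer A k & moves (projT2 p) k) ->
  exists g, forall p, S p -> moves (projT2 p) g.
Proof.
move=> /countable_injP [iota iotaI] Sns.
pose P := [set s : set (M * M) | finite_set s /\ exists g, extends g s].
pose D i := [set s : set (M * M) | forall p, S p -> iota p = i ->
  forall g, extends g s -> moves (projT2 p) g].
have Padd s g c : finite_set s -> extends g s -> P ((c, g c) |` s).
  move=> fs gs; split; first by rewrite finite_setU; split=> //; exact: finite_set1.
  by exists g => p [->|/gs].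
have [|s [_ [g gs]]|s c [fs [g gs]]|s d [fs [g gs]]|i s [fs [g0 g0s]]|g [_ _ gD]]
  := back_and_forth (P := P) (D := D) (s0 := set0) M_countable.
- by split=> //; exists 1%g.
- exact: extends_elementary gs.
- by exists (g c); exact: Padd.
- by exists (g^-1%g d); rewrite -{2}(autVK g d); exact: Padd.
- have [[p [Sp pi]]|np] := pselect (exists p, S p /\ iota p = i); last first.
    exists s; split=> //; first by split=> //; exists g0.
    by move=> p Sp pi; case: np; exists p.
  (* If [g0] preserves the set, composing it with a mover that fixes the domain of [s] gives an
     extension that moves it. Recording [g] on the entries of [b] then binds all later
     extensions. *)
  have [g gs [b gb]] : exists2 g, extends g s & moves (projT2 p) g.
    have [mg0|/forallNP mg0] := pselect (moves (projT2 p) g0); first by exists g0.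
    have [k ks [a ka]] := Sns p Sp _ (finite_image fst fs).
    exists (g0 * k)%g => [q sq|] /=; first by rewrite ks ?g0s//; exists q.
    exists a => Ega; apply: ka; apply: (iff_trans Ega); apply: iff_sym.
    exact: contrapT (mg0 (k \o a)).
  exists (range (fun j => (b j, g (b j))) `|` s); split.
  + by move=> q; right.
  + split; first by rewrite finite_setU; split=> //; exact/finite_image/finite_finset.
    by exists g => q [[j _ <-]|/gs].
  + move=> q Sq qi h hs; have -> : q = p by apply: iotaI; rewrite ?inE// qi pi.
    exists b; rewrite (_ : h \o b = g \o b) //; apply: funext => j /=.
    by apply: (hs (b j, g (b j))); left; exists j.
exists g => p Sp; have [s [_ gs sD]] := gD (iota p).
exact: sD gs.
Qed.

Hypothesis olig : forall V, finite_set [set: V] -> finitely_many_orbits M V.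

(* The sets of the finite orbit of [X] cut [M^n] into finitely many classes; the
   corresponding imaginary sort is finite, so all its elements lie in acl(∅),
   and [X] is a union of classes. *)
Lemma finite_orbit_invariant (H : set (aut M)) n (X : set ('I_n -> M)) :
  no_compact_quotients H ->
  (forall h a, H h -> X a -> X (h \o a)) ->
  finite_set (range (fun g : aut M => [set a | X (g \o a)])) ->
  forall g a, X a -> X (g \o a).
Proof.
move=> ncq HX; set O := range _ => finO.
pose E a b := forall Y, O Y -> Y a <-> Y b.
have Eg g a b : E a b -> E (g \o a) (g \o b).
  by move=> ab _ [h _ <-]; apply: (ab [set a | X ((h * g)%g \o a)]); exists (h * g)%g.
have defE : definable [set c : 'I_n + 'I_n -> M | E (c \o inl) (c \o inr)].
  by apply: invariant_definable => // g a; exact: Eg.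
have Erefl a : [set: 'I_n -> M] a -> E a a by move=> _ Y _.
have Esym a b : E a b -> E b a by move=> ab Y OY; apply: iff_sym; exact: ab.
have Etrans b a c : E a b -> E b c -> E a c 
  by move=> ab bc Y OY; exact: iff_trans (ab Y OY) (bc Y OY).
pose Q := ImaginarySort (@definableT L M 'I_n) defE (fun a b _ => conj I I)
  Erefl Esym Etrans.
pose cls a : eq_quotient Q := exist _ (E a) (ex_intro2 _ _ a I erefl).
have finQ : finite_set [set: eq_quotient Q].
  (* A class is determined by the members of [O] containing it, and [O] has finitely many
     subsets. *)
  pose phi a := [set Y | O Y /\ Y a].
  have /finite_set_range [k [f fE]] : finite_set (range phi).
    by apply: sub_finite_set (finite_set_subsets finO) => _ [a _ <-] Y [].
  have /choice [r rP] i : exists a, phi a = f i.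
    by have : range f (f i) by []; rewrite -fE => -[a _ <-]; exists a.
  apply: (@sub_finite_set _ _ (range (fun i => cls (r i)))); last first.
    exact/finite_image/finite_finset.
  move=> [C Ca] _; have [a _ CE] := Ca.
  have [i _ fi] : range f (phi a) by rewrite -fE; exists a.
  exists i => //; apply: eq_exist; rewrite /= CE.
  have aE : E a (r i).
    move=> Y OY; have pE : (O Y /\ Y (r i)) = (O Y /\ Y a) :=
      congr1 (@^~ Y) (etrans (rP i) fi).
    split=> ?; first by have [] : O Y /\ Y (r i) by rewrite pE.
    by have [] : O Y /\ Y a by rewrite -pE.
  by apply/seteqP; split=> b Eb; [exact: Etrans aE Eb|exact: Etrans (Esym _ _ aE) Eb].
move=> g a Xa; have [h Hh gh] := ncq g.
have : acl0 (N := Meq M) (s := Some Q) (cls a).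
  exists (FImp (FBot (L := eq_language M) (fun=> Some Q))
    (FBot (L := eq_language M) (fun=> Some Q))).
  by split=> //=; apply: sub_finite_set finQ.
move=> /gh /(congr1 sval) /= ghE.
(* [g] and [h] send the class of [a] to the same class, so [g \o a = h \o b] for some [b] equivalent
   to [a], and [b] lies in [X]. *)
have : [set h \o b | b in E a] (g \o a) by rewrite -ghE; exists a.
move=> [b ab <-]; apply: HX => //.
have OX : O X by exists 1%g.
by apply/(ab X OX).
Qed.

Lemma oligomorphic_orbits (H : set (aut M)) V :
  oligomorphic H -> H 1%g -> finite_set [set: V] -> finitely_many_orbits M V.
Proof.
move=> oH H1 /finite_set_range [m [q qV]].
have /choice [q' qK] v : exists i, q i = v.
  by have [i _ <-] : range q v; [rewrite -qV|exists i].
have [n [f fE]] := finite_set_range (oH m).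
have /choice [r rP] i : exists a, tuple_orbit H a = f i.
  by have : range f (f i) by []; rewrite -fE => -[a _ <-]; exists a.
exists n, (fun i => r i \o q') => a.
have [i _ fi] : range f (tuple_orbit H (a \o q)) by rewrite -fE; exists (a \o q).
have : tuple_orbit H (a \o q) (a \o q) by exists 1%g.
rewrite -fi -rP => -[g _ gE]; exists i, g; apply: funext => v.
by have /= -> := congr1 (@^~ (q' v)) gE; rewrite qK.
Qed.

(** An invariant set is the union of the [H]-orbits that it contains. *)
Lemma finite_invariant_sets (H : set (aut M)) n : oligomorphic H -> H 1%g ->
  finite_set [set X : set ('I_n -> M) | forall h a, H h -> X a -> X (h \o a)].
Proof.
move=> oH H1; have := finite_image
  (fun C => \bigcup_(B in C) B) (finite_set_subsets (oH n)).
apply: sub_finite_set => X HX;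
  exists [set B | B `<=` X /\ range (tuple_orbit H (n := n)) B].
  by move=> B [].
apply/seteqP; split=> [a [B [BX _] /BX]//|a Xa].
exists (tuple_orbit H a); last by exists 1%g.
by split; [move=> _ [h Hh <-]; exact: HX|exists a].
Qed.

End Invariants.

(** * Neighbourhoods in Aut(M) and topological generation *)

(** Agreement with [g] on finite sets generates a filter. It converges to [g] because pointwise
    convergence is tested one coordinate at a time, in a discrete space. *)
Lemma open_aut L (M : structure L) (O : set (aut M)) g : open O -> O g ->
  exists A, finite_set A /\ forall k : aut M, (forall c, A c -> k c = g c) -> O k.
Proof.
move=> [O' oO' <-] Og.
pose F : set_system {ptws {classic M} -> discrete_topology {classic M}} :=
  [set Z | exists A, finite_set A /\ [set f | forall c, A c -> f c = g c] `<=` Z].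
have FF : Filter F.
  split.
  - by exists set0.
  - move=> P Q [A [fA AP]] [B [fB BQ]]; exists (A `|` B).
    rewrite finite_setU; split=> // f fg; split; [apply: AP|apply: BQ] => c ?.
      by apply: fg; left.
    by apply: fg; right.
  - by move=> P Q PQ [A [fA AP]]; exists A; split=> // f /AP /PQ.
have Fg : F --> (g : {ptws {classic M} -> discrete_topology {classic M}}).
  apply/cvg_sup => c Z [_ [[U _ <-] Ug UZ]].
  exists [set c]; split=> [|f fg]; first exact: finite_set1.
  by apply: UZ; rewrite /preimage /= fg.
have [A [fA AO]] : F O' by apply: Fg; exact: open_nbhs_nbhs.
by exists A; split=> // k kg; exact: (AO k).
Qed.


Theorem theorem5p11 (L : language) (M : structure L) (H : set (aut M)) :
  countable_language L ->
  countable [set: M] ->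
  omega_categorical M ->
  is_subgroup H ->
  closed H ->
  oligomorphic H ->
  no_compact_quotients H ->
  exists g1 g2 : aut M, dense (generated_subgroup (H `|` [set g1; g2])).
Proof.
move=> _ cM _ [H1 _ _] _ oH ncq.
have olig V : finite_set [set: V] -> finitely_many_orbits M V.
  exact: oligomorphic_orbits oH H1.
pose Hinv n := [set X : set ('I_n -> M) | forall h a, H h -> X a -> X (h \o a)].
pose T := {n & set ('I_n -> M)}.
pose actT (g : aut M) (p : T) : T :=
  existT _ (projT1 p) [set a | projT2 p (g^-1%g \o a)].
have actTE (g : aut M) n (X : set ('I_n -> M)) :
    (forall a, X a <-> X (g^-1%g \o a)) ->
    actT g (existT _ n X) = existT _ n X.
  by move=> gX; congr existT; apply/seteqP; split=> a /(gX a).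
have actT1 p : actT 1%g p = p.
  by case: p => n X; apply: actTE => a; rewrite invg1.
have actTM g h p : actT (g * h)%g p = actT g (actT h p).
  by congr existT; apply/seteqP; split=> a; rewrite /= invgM.
pose S := [set p : T | Hinv (projT1 p) (projT2 p) /\ forall A, finite_set A ->
  exists2 k, fixer A k & moves (projT2 p) k].
have cS : countable S.
  apply: (@sub_countable _ _ _ (\bigcup_n [set (existT _ n X : T) | X in Hinv n])).
    apply: subset_card_le => -[n X] [HX _].
    by exists n => //; exists X.
  apply: bigcup_countable => // n _; apply: finite_set_countable.
  exact/finite_image/finite_invariant_sets.
have [g1 g1P] := generic_mover cM cS (fun p Sp => Sp.2).
have [g2 g2P] := fixed_point_free olig actT1 actTM cM.
exists g1, g2 => O [g Og] oO; set K := generated_subgroup _.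
have [KH Kg1 Kg2] : [/\ H `<=` K, K g1 & K g2].
  by split=> [h Hh N|N|N] [_ HN]; apply: HN; [left|right; left|right; right].
have [K1 KM KV] : is_subgroup K.
  split=> [N [[]]//|a b Ka Kb N NS|a Ka N NS]; have [[_ NM NV] _] := NS.
    by apply: NM; [exact: Ka|exact: Kb].
  by apply: NV; exact: Ka.
have [A [/finite_set_range [n [a ->]] AO]] := open_aut oO Og.
(* If [g \o a] is in the [K]-orbit of [a], some element of [K] agrees with [g] on the finite set
   [A], hence lies in [O]. *)
pose X := [set k \o a | k in K].
have KX k b : K k -> X b -> X (k \o b).
  by move=> Kk [l Kl <-]; exists (k * l)%g => //; exact: KM.
have KXV k b : K k -> X b <-> X (k \o b).
  move=> Kk; split=> [|Xkb]; first exact: KX.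
  have := KX _ _ (KV _ Kk) Xkb; congr X; apply: funext => i /=; exact: autK.
suff [k Kk ka] : X (g \o a).
  by exists k; split=> //; apply: AO => _ [i _ <-]; exact: (congr1 (@^~ i) ka).
have HX h b : H h -> X b -> X (h \o b) by move=> /KH; exact: KX.
have Xa : X a by exists 1%g.
apply: contrapT => nXga.
have infX : infinite_set (range (fun g : aut M => [set b | X (g \o b)])).
  move=> finX; apply: nXga; exact: finite_orbit_invariant ncq HX finX _ _ Xa.
(* If the stabilizer of [X] is not open, [X] belongs to [S] and [g1] moves it; if it is open, [g2]
   moves it, the orbit being infinite. Both contradict invariance under [K]. *)
have [open|nopen] := pselect
  (exists2 A, finite_set A & forall k, fixer A k -> ~ moves X k); last first.
  have [|b nXb] := g1P (existT _ n X).
    split=> // B fB; apply: contrapT => nk; apply: nopen.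
    by exists B => // k kB mk; apply: nk; exists k.
  by apply: nXb; exact: KXV.
apply: (g2P (existT _ n X)).
- have [B fB BX] := open; exists B => // k kB; apply: actTE => b.
  apply: contrapT => nb; apply: (BX k^-1%g); last by exists b.
  by have [_ _ ] := fixer_subgroup B; apply.
- move=> finX; apply: infX.
  (* [f] recovers the set from a pair, so a finite orbit in [T] would give finitely many translates
     of [X]. *)
  pose f (p : T) := [set b | exists2 Y, p = existT _ n Y & Y b].
  apply: sub_finite_set (finite_image f finX) => _ [k _ <-].
  exists (actT k^-1%g (existT _ n X)); first by exists k^-1%g.
  apply/seteqP; split=> [b [Y]|b Xkb]; last first.
    by exists [set c | X (k \o c)]; rewrite // /actT invgK.
  move=> XY; have <- := inj_pair2_eq_dec _ Nat.eq_dec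
    (fun m => set ('I_m -> M)) _ _ _ XY.
  by rewrite /= invgK.
- by apply: actTE => b; apply: KXV; exact: KV.
Qed.
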